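(* Let $X$ be a set of alternatives, let $f$ be an anonymous social choice correspondence, let $\Pi$ be a permutation process over $X$, and let $A\subseteq X$ be a nonempty finite set. (1) If $f$ is PMD-efficient and $\Pi$ is PM-compatible, then there exists $a\in A$ such that $a\rhd^{pm}_{\Pi}b$ for all $b\in A$; moreover, $a\in f(\Pi(A))$. (2) If $f$ is PosD-efficient and $\Pi$ is Pos-compatible, then there exists $a\in A$ such that $a\rhd^{pos}_{\Pi(A)}b$ for all $b\in A$; moreover, $a\in f(\Pi(A))$. (3) If $f$ is PosD-efficient and $\Pi$ is strongly Pos-compatible, then there exists $a\in A$ such that $a\rhd^{pos}_{\Pi}b$ for all $b\in A$; moreover, $a\in f(\Pi(A))$.
   Context: For a nonempty finite $A\subseteq X$, $S_A$ is the set of bijections $\sigma:A\to\{1,\dots,|A|\}$ (rankings); $\sigma(a)$ is the position of $a$, and $a>_\sigma b$ means $\sigma(a)<\sigma(b)$. An anonymous preference profile over $A$ is a probability distribution $\pi$ on $S_A$. An (anonymous) social choice correspondence (SCC) $f$ assigns to every anonymous preference profile $\pi$ over every nonempty finite $A\subseteq X$ a nonempty subset $f(\pi)\subseteq A$. A permutation process $\Pi$ over $X$ assigns to each nonempty finite $A\subseteq X$ a probability distribution $\Pi(A)$ on $S_A$ (regarded as an anonymous preference profile over $A$). For a profile $\pi$ over $A$ and $a,b\in A$: $a\rhd^{pm}_\pi b$ (PM-dominance) iff $\sum_{\sigma:a>_\sigma b}\pi(\sigma)\ge\sum_{\sigma:b>_\sigma a}\pi(\sigma)$ (so $a\rhd^{pm}_\pi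 a$ trivially). With $s_j(a)=\sum_{\sigma:\sigma(a)\le j}\pi(\sigma)$, $a\rhd^{pos}_\pi b$ (Pos-dominance) iff $s_j(a)\ge s_j(b)$ for all $j\in\{1,\dots,|A|\}$. $f$ is PMD-efficient (resp. PosD-efficient) if for every profile $\pi$ over a finite $A$ and all $a,b\in A$ with $a\rhd^{pm}_\pi b$ (resp. $a\rhd^{pos}_\pi b$), $b\in f(\pi)$ implies $a\in f(\pi)$. For $a,b\in X$, $a\rhd^{pm}_\Pi b$ (resp. $a\rhd^{pos}_\Pi b$) iff for every finite $A\subseteq X$ with $a,b\in A$ one has $a\rhd^{pm}_{\Pi(A)}b$ (resp. $a\rhd^{pos}_{\Pi(A)}b$). $\Pi$ is PM-compatible (resp. Pos-compatible) if for every $A\subseteq X$ the restriction of $\rhd^{pm}_\Pi$ (resp. $\rhd^{pos}_\Pi$) to $A$ is a total preorder (transitive and complete). $\Pi$ is strongly Pos-compatible if it is Pos-compatible and for every nonempty finite $A\subseteq X$, $\rhd^{pos}_{\Pi(A)}$ equals the restriction of $\rhd^{pos}_\Pi$ to $A$. *)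

(* Defs.v *)
From mathcomp Require Import all_boot all_order all_algebra finmap.
From mathcomp Require Import boolp classical_sets reals.

Set Implicit Arguments.
Unset Strict Implicit.
Unset Printing Implicit Defensive.

Import Order.TTheory GRing.Theory Num.Theory.

Local Open Scope fset_scope.
Local Open Scope ring_scope.

(* An arbitrary set of alternatives is a [choiceType]; its finite subsets are
   the [A : {fset X}], and such an [A] is also used as the finite type of its
   elements.  Positions are stored 0-based in ['I_#|` A|]; the actual position
   in {1, ..., |A|} is [rank s a]. *)
Definition ranking (X : choiceType) (A : {fset X}) : finType :=
  {s : {ffun A -> 'I_#|` A|} | `[< bijective s >]}.

Definition rank (X : choiceType) (A : {fset X}) (s : ranking A) (a : A) : nat :=
  (val s a).+1.

Definition above (X : choiceType) (A : {fset X}) (s : ranking A) (a b : A) :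
    bool :=
  (rank s a < rank s b)%N.

Record profile (R : realType) (X : choiceType) (A : {fset X}) := Profile {
  weight :> {ffun ranking A -> R};
  weight_ge0 : forall s, 0 <= weight s;
  weight_sum1 : \sum_s weight s = 1 }.

(* The carrier is also defined at [A = fset0], where it adds no data:
   [{set fset0}] is a singleton. *)
Record scc (R : realType) (X : choiceType) := SCC {
  choice_set :> forall A : {fset X}, profile R A -> {set A};
  choice_set_neq0 : forall (A : {fset X}) (p : profile R A),
    A != fset0 -> choice_set p != finset.set0 }.

(* Here too [fset0] adds no data: there is a single profile over it. *)
Definition permutation_process (R : realType) (X : choiceType) :=
  forall A : {fset X}, profile R A.

Definition pm_dom (R : realType) (X : choiceType) (A : {fset X})
    (p : profile R A) (a b : A) : Prop :=
  \sum_(s : ranking A | above s a b) p s >=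
  \sum_(s : ranking A | above s b a) p s.

Definition cumul (R : realType) (X : choiceType) (A : {fset X})
    (p : profile R A) (j : nat) (a : A) : R :=
  \sum_(s : ranking A | (rank s a <= j)%N) p s.

Definition pos_dom (R : realType) (X : choiceType) (A : {fset X})
    (p : profile R A) (a b : A) : Prop :=
  forall j : nat, (1 <= j <= #|` A|)%N -> cumul p j a >= cumul p j b.

Definition PMD_efficient (R : realType) (X : choiceType) (f : scc R X) : Prop :=
  forall (A : {fset X}) (p : profile R A) (a b : A),
    pm_dom p a b -> b \in f A p -> a \in f A p.

Definition PosD_efficient (R : realType) (X : choiceType) (f : scc R X) :
    Prop :=
  forall (A : {fset X}) (p : profile R A) (a b : A),
    pos_dom p a b -> b \in f A p -> a \in f A p.

Definition process_pm_dom (R : realType) (X : choiceType)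
    (Pi : permutation_process R X) (a b : X) : Prop :=
  forall (A : {fset X}) (aA : a \in A) (bA : b \in A),
    pm_dom (Pi A) [` aA] [` bA].

Definition process_pos_dom (R : realType) (X : choiceType)
    (Pi : permutation_process R X) (a b : X) : Prop :=
  forall (A : {fset X}) (aA : a \in A) (bA : b \in A),
    pos_dom (Pi A) [` aA] [` bA].

Definition total_preorder_on (X : Type) (A : set X) (r : X -> X -> Prop) :
    Prop :=
  (forall x y z, A x -> A y -> A z -> r x y -> r y z -> r x z) /\
  (forall x y, A x -> A y -> r x y \/ r y x).

Definition PM_compatible (R : realType) (X : choiceType)
    (Pi : permutation_process R X) : Prop :=
  forall A : set X, total_preorder_on A (process_pm_dom Pi).

Definition Pos_compatible (R : realType) (X : choiceType)
    (Pi : permutation_process R X) : Prop :=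
  forall A : set X, total_preorder_on A (process_pos_dom Pi).

Definition strongly_Pos_compatible (R : realType) (X : choiceType)
    (Pi : permutation_process R X) : Prop :=
  Pos_compatible Pi /\
  forall A : {fset X}, A != fset0 ->
    forall a b : A, pos_dom (Pi A) a b <-> process_pos_dom Pi (val a) (val b).

(* Main.v *)
Require Import Defs.
From mathcomp Require Import all_boot all_order all_algebra finmap.
From mathcomp Require Import boolp classical_sets reals.

Local Open Scope fset_scope.
Local Open Scope ring_scope.

(** Compatibility, taken at the whole of [X], makes process dominance a total preorder, so the
    nonempty finite set [A] has a greatest element [a] for it ([total_preorder_greatest]). Process
    dominance specializes to dominance in the single profile [Pi A]. Since [f A (Pi A)] contains
    some alternative, and [a] dominates it there, efficiency puts [a] in the choice set
    ([greatest_chosen]). *)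

Lemma total_preorder_greatest (T : eqType) (r : T -> T -> Prop) (s : seq T) :
  total_preorder_on setT r -> s != [::] ->
  exists2 a, a \in s & forall b, b \in s -> r a b.
Proof.
move=> [r_trans r_total]; elim: s => [//|x [|y s] IHs] _.
  exists x => [|b]; first by rewrite mem_head.
  by rewrite inE => /eqP ->; case: (r_total x x).
(* Compare the head [x] with the greatest element [a] of the tail: the winner is greatest overall,
   and when it is [x], it dominates the tail by transitivity through [a]. *)
have [//|a a_s a_max] := IHs; case: (r_total x a) => // [r_xa|r_ax].
  exists x => [|b]; first exact: mem_head.
  rewrite inE => /orP [/eqP ->|/a_max]; first by case: (r_total x x).
  exact: r_trans.
exists a => [|b]; first by rewrite inE a_s orbT.
by rewrite inE => /orP [/eqP ->|/a_max].
Qed.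

(** Common core of the PM and Pos cases: [S] stands for the choice set, and its upward closure under
    [r] is what efficiency provides. The greatest element lies above any witness [c] of
    nonemptiness. *)
Lemma greatest_chosen (X : choiceType) (r : X -> X -> Prop) (A : {fset X})
    (S : {set A}) :
  total_preorder_on setT r -> A != fset0 -> S != finset.set0 ->
  (forall a b : A, r (val a) (val b) -> b \in S -> a \in S) ->
  exists a : A, (forall b : A, r (val a) (val b)) /\ a \in S.
Proof.
move=> r_tot A_neq0 /set0Pn [c cS] S_up.
have s_neq0 : (A : seq X) != [::].
  by apply: contraNneq A_neq0 => A0; rewrite -cardfs_eq0 A0.
have [a aA a_max] := @total_preorder_greatest _ r A r_tot s_neq0.
have a_max' (b : A) : r a (val b) by apply: a_max; exact: fsvalP.
by exists [` aA]; split=> //; exact: S_up cS.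
Qed.

Lemma process_pm_domW (R : realType) (X : choiceType)
    (Pi : permutation_process R X) (A : {fset X}) (a b : A) :
  process_pm_dom Pi (val a) (val b) -> pm_dom (Pi A) a b.
Proof. by case: a b => [a aA] [b bA]; exact. Qed.

Lemma process_pos_domW (R : realType) (X : choiceType)
    (Pi : permutation_process R X) (A : {fset X}) (a b : A) :
  process_pos_dom Pi (val a) (val b) -> pos_dom (Pi A) a b.
Proof. by case: a b => [a aA] [b bA]; exact. Qed.

Theorem theorem1 (R : realType) (X : choiceType) (f : scc R X)
    (Pi : permutation_process R X) (A : {fset X}) (A_neq0 : A != fset0) :
  (PMD_efficient f -> PM_compatible Pi ->
     exists a : A, (forall b : A, process_pm_dom Pi (val a) (val b)) /\
       a \in f A (Pi A)) /\
  (PosD_efficient f -> Pos_compatible Pi ->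
     exists a : A, (forall b : A, pos_dom (Pi A) a b) /\
       a \in f A (Pi A)) /\
  (PosD_efficient f -> strongly_Pos_compatible Pi ->
     exists a : A, (forall b : A, process_pos_dom Pi (val a) (val b)) /\
       a \in f A (Pi A)).
Proof.
have f_neq0 := choice_set_neq0 f (Pi A) A_neq0.
(* Serves both Pos claims: the strong one takes it as is, the other restricts dominance to
   [Pi A]. *)
have pos_greatest : PosD_efficient f -> Pos_compatible Pi ->
    exists a : A, (forall b : A, process_pos_dom Pi (val a) (val b)) /\
      a \in f A (Pi A).
  move=> f_eff Pi_compat; apply: greatest_chosen => // a b /process_pos_domW.
  exact: f_eff.
split=> [f_eff Pi_compat|].
  by apply: greatest_chosen => // a b /process_pm_domW; exact: f_eff.
split=> [f_eff Pi_compat|f_eff [Pi_compat _]]; last exact: pos_greatest.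
have [a [a_max a_f]] := pos_greatest f_eff Pi_compat.
by exists a; split=> // b; apply: process_pos_domW.
Qed.
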